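(* Let $\mathbb{K}$ be any field. Let $X$ and $Y$ be (disjoint) nonempty sets of any cardinality and let $d$ be a degree function on the free nonunitary semigroup $F=\langle X,Y\rangle$ on the free generating set $X\cup Y$, such that $d(x)>0$ and $d(y)<0$ for all $x\in X$, $y\in Y$, and such that, whenever a finite sum $$\sum_{x_i\in X}p_i\,d(x_i)+\sum_{y_j\in Y}q_j\,d(y_j)=0$$ for some $p_i,q_j\in\mathbb{Q}$ with $p_i,q_j\ge 0$, then $p_i=q_j=0$ for all $x_i\in X$, $y_j\in Y$. Let $a,b\in\mathbb{R}$, $a,b>0$, and suppose there exist $x_0\in X$ and $y_0\in Y$ such that $d(x_0)\le a$ and $d(y_0)\ge -b$. Let $S=F/\mathrm{id}_F\{w\in F\mid |d(w)|\ge a+b\}$. Let $\Omega=z_1z_2\cdots z_n\cdots$ be an infinite word obtained by choosing inductively letters $z_n\in X\cup Y$ such that the words $w_n=z_1\cdots z_n=w_{n-1}z_n$ satisfy $d(w_n)\in(-b,a)$ for all $n\ge1$ (for $n\ge 2$ one may for example choose $z_n=y_0$ if $d(w_{n-1})>0$ and $z_n=x_0$ if $d(w_{n-1})<0$). For $T=S$ and $T=S(\Omega)$ put $$T_+=\{s\in T\setminus\{0\}\mid d(s)>0\}\cup\{0\},\qquad T_-=\{s\in T\setminus\{0\}\mid d(s)<0\}\cup\{0\}.$$ Then: (1) the contracted semigroup algebras $\mathbb{K}_0S$ and $\mathbb{K}_0S(\Omega)$ are not nil; (2) $\mathbb{K}_0S$ and $\mathbb{K}_0S(\Omega)$ are direct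 sums (as vector spaces) of their subalgebras $\mathbb{K}_0S_+$, $\mathbb{K}_0S_-$ and $\mathbb{K}_0S(\Omega)_+$, $\mathbb{K}_0S(\Omega)_-$, respectively; (3) these four subalgebras are locally nilpotent and any of their finitely generated ideals is nilpotent.
   Context: The free nonunitary semigroup on a set consists of all nonempty finite words under concatenation. A degree function on it is a map $d$ to $\mathbb{R}$ with $d(w_1w_2)=d(w_1)+d(w_2)$ for all words $w_1,w_2$. $\mathrm{id}_F(W)$ is the two-sided ideal of $F$ generated by $W$. For an ideal $\mathbb{I}$ of $F$, the Rees factor $F/\mathbb{I}$ is the semigroup $(F\setminus\mathbb{I})\cup\{0\}$ in which all elements of $\mathbb{I}$ are identified with $0$; $d$ induces a degree function on its nonzero elements. For an infinite word $\Omega$ over $X\cup Y$, $S(\Omega)$ is the Rees factor $F/\mathbb{I}$, where $\mathbb{I}$ is the ideal of all words in $F$ which are not subwords (blocks of consecutive letters) of $\Omega$. For a semigroup $T$ with zero, $\mathbb{K}_0T$ is the contracted semigroup algebra: the associative $\mathbb{K}$-algebra with vector space basis $T\setminus\{0\}$ and multiplication induced by that of $T$ (with the zero of $T$ identified with $0$). An algebra is nil if each of its elements is nilpotent, and locally nilpotent if every finitely generated subalgebra is nilpotent. Finitely generated ideals of a subalgebra are ideals of that subalgebra itself generated by finite subsets.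
   Formalization: Claim (1) for S(Ω) additionally assumes that some finite set of letters has arbitrarily long blocks of Ω over it; without this it fails, e.g. for infinite X, Y and Ω with pairwise distinct letters, where the algebra is nil. *)

(* Defs.v *)
From HB Require Import structures.
From mathcomp Require Import all_boot all_order all_algebra finmap.
From mathcomp Require Import boolp classical_sets functions cardinality reals.
From mathcomp Require Import monalg.

Set Implicit Arguments.
Unset Strict Implicit.
Unset Printing Implicit Defensive.

Import Order.TTheory GRing.Theory Num.Theory.

Local Open Scope classical_set_scope.
Local Open Scope ring_scope.

(* Semigroup products are [*%g], in group_scope; the library has no
   semigroups with zero and no nonunital algebras. *)

HB.mixin Record Semigroup_hasZero T of Semigroup T := {
  szero : T;
  smul0s : forall x : T, (szero * x)%g = szero;
  smuls0 : forall x : T, (x * szero)%g = szero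
}.

#[short(type="semigroup0Type")]
HB.structure Definition Semigroup0 :=
  { T of Semigroup_hasZero T & Semigroup T }.

HB.mixin Record Lmodule_isNUAlgebra (K : pzRingType) A
    of Semigroup A & GRing.Lmodule K A := {
  numulDl : forall x y z : A, ((x + y) * z)%g = (x * z)%g + (y * z)%g;
  numulDr : forall x y z : A, (x * (y + z))%g = (x * y)%g + (x * z)%g;
  nuscaleAl : forall (c : K) (x y : A), ((c *: x) * y)%g = c *: (x * y)%g;
  nuscaleAr : forall (c : K) (x y : A), (x * (c *: y))%g = c *: (x * y)%g
}.

(* Associative, not necessarily unital, K-algebras; since no unit is
   available, powers and n-fold products below start from one factor. *)
#[short(type="nuAlgType")]
HB.structure Definition NUAlgebra (K : pzRingType) :=
  { A of Lmodule_isNUAlgebra K A & Semigroup A & GRing.Lmodule K A }.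

Section AlgebraNotions.
Context {K : pzRingType} {A : nuAlgType K}.
Implicit Types (B G J : set A).

Definition subspace B :=
  [/\ B 0, forall x y, B x -> B y -> B (x + y)
    & forall (c : K) x, B x -> B (c *: x)].

Definition subalgebra B :=
  subspace B /\ forall x y, B x -> B y -> B (x * y)%g.

(* J is a two-sided ideal of the algebra B (not of A). *)
Definition ideal_of B J :=
  [/\ J `<=` B, subspace J
    & forall x y, B x -> J y -> J (x * y)%g /\ J (y * x)%g].

Definition nilpotent_elt (x : A) := exists n, iter n (fun y => (x * y)%g) x = 0.

Definition nil_algebra B := forall x, B x -> nilpotent_elt x.

Definition nilpotent_algebra B :=
  exists n, forall (x : A) (s : seq A), size s = n ->
    (forall y, y \in x :: s -> B y) -> foldl (fun u v => (u * v)%g) x s = 0.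

Definition locally_nilpotent B :=
  forall G, finite_set G -> G `<=` B ->
    nilpotent_algebra (smallest subalgebra G).

Definition fg_ideals_nilpotent B :=
  forall G, finite_set G -> G `<=` B ->
    nilpotent_algebra (smallest (ideal_of B) G).

Definition direct_sum B J :=
  (forall z : A, exists x y, [/\ B x, J y & z = x + y]) /\ B `&` J = [set 0].

End AlgebraNotions.

Section FreeSemigroup.
Variable A : choiceType.

Record free_semigroup := Word { letters :> seq A; _ : ~~ nilp letters }.

HB.instance Definition _ := [isSub for letters].
HB.instance Definition _ := [Choice of free_semigroup by <:].

Fact concat_subproof (u v : free_semigroup) : ~~ nilp (u ++ v).
Proof. by case: u => -[]. Qed.

Definition concat (u v : free_semigroup) := Word (concat_subproof u v).

Fact concatA : associative concat.
Proof. by move=> u v w; apply: val_inj; rewrite /= catA. Qed.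

HB.instance Definition _ := isSemigroup.Build free_semigroup concatA.

Definition letter (z : A) : free_semigroup := @Word [:: z] isT.

(* [block Omega k n] is the word Omega_k ... Omega_(k+n), of length n+1. *)
Definition block (Omega : nat -> A) (k n : nat) : free_semigroup :=
  @Word [seq Omega i | i <- iota k n.+1] isT.

End FreeSemigroup.

Section Rees.
Variable F : semigroupType.

Definition semigroup_ideal (I : set F) :=
  forall x y, I y -> I (x * y)%g /\ I (y * x)%g.

Record sideal := SIdeal {
  sideal_set :> set F;
  sidealP : semigroup_ideal sideal_set
}.

Fact gen_ideal_subproof (W : set F) :
  semigroup_ideal (smallest semigroup_ideal W).
Proof.
by move=> x y Iy; split=> J [JI WJ]; have := JI x y (Iy J (conj JI WJ)); case.
Qed.

Definition gen_ideal (W : set F) : sideal := SIdeal (@gen_ideal_subproof W).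

Variable I : sideal.

(* [None] is the zero of F / I. *)
Definition rees := option {w : F | w \notin (I : set F)}.

HB.instance Definition _ := Choice.on rees.

Definition rees_mul (s t : rees) : rees :=
  if s is Some u then if t is Some v then insub (val u * val v)%g else None
  else None.

Fact rees_mulA : associative rees_mul.
Proof.
have out (w : F) : (w \notin (I : set F)) = false -> (I : set F) w.
  by move/negbFE/set_mem.
have bad (w : F) : (I : set F) w -> (w \notin (I : set F)) = false.
  by move=> Iw; apply/negbF/mem_set.
move=> [u|] [v|] [w|] //=; last by case: insub.
case: (insubP _ (sval v * sval w)%g) => [vw _ vwE|/negbTE/out Ivw];
  case: (insubP _ (sval u * sval v)%g) => [uv _ uvE|/negbTE/out Iuv] //=.
- by rewrite -[sval vw]/(\val vw) -[sval uv]/(\val uv) vwE uvE mulgA.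
- rewrite -[sval vw]/(\val vw) vwE mulgA insubF //.
  by apply: bad; case: (sidealP (sval w) Iuv).
- rewrite -[sval uv]/(\val uv) uvE -mulgA insubF //.
  by apply: bad; case: (sidealP (sval u) Ivw).
Qed.

HB.instance Definition _ := isSemigroup.Build rees rees_mulA.

Fact rees_mul0s (s : rees) : ((None : rees) * s)%g = None.
Proof. by []. Qed.

Fact rees_muls0 (s : rees) : (s * (None : rees))%g = None.
Proof. by case: s. Qed.

HB.instance Definition _ :=
  Semigroup_hasZero.Build rees rees_mul0s rees_muls0.

End Rees.

Section ContractedAlgebra.
Variables (K : fieldType) (T : semigroup0Type).

Definition nonzero := {t : T | t != szero}.

Definition contracted := {malg K[nonzero]}.

HB.instance Definition _ := GRing.Lmodule.on contracted.

(* The image in K_0 T of an element of T: a basis vector, or 0 for zero. *)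
Definition cbasis (t : T) : contracted :=
  if insub t is Some u then << (u : nonzero) >> else 0.

Definition cmul (f g : contracted) : contracted :=
  \sum_(s <- msupp f) \sum_(t <- msupp g)
    (f@_s * g@_t) *: cbasis (val s * val t)%g.

(* The span of the nonzero elements of B, i.e. the contracted algebra of B
   inside K_0 T when B is a subsemigroup of T containing zero. *)
Definition contracted_sub (B : set T) : set contracted :=
  [set f | forall s : nonzero, s \in msupp f -> B (val s)].

Let lext (h : nonzero -> contracted) (f : contracted) : contracted :=
  \sum_(s <- msupp f) f@_s *: h s.

Let lextW (D : {fset nonzero}) h f : (msupp f `<=` D)%fset ->
  lext h f = \sum_(s <- D) f@_s *: h s.
Proof.
move=> fD; rewrite /lext (big_fset_incl _ fD) //= => s _ sf.
by rewrite mcoeff_outdom // scale0r.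
Qed.

Let lextD h f g : lext h (f + g) = lext h f + lext h g.
Proof.
rewrite (lextW h (msuppD_le f g)) (lextW h (fsubsetUl (msupp f) (msupp g))).
rewrite (lextW h (fsubsetUr (msupp f) (msupp g))) -big_split /=.
by apply: eq_bigr => s _; rewrite mcoeffD scalerDl.
Qed.

Let lextZ h c f : lext h (c *: f) = c *: lext h f.
Proof.
rewrite (lextW h (msuppZ_le c f)) /lext scaler_sumr.
by apply: eq_bigr => s _; rewrite mcoeffZ scalerA.
Qed.

Let cmulE f g :
  cmul f g = lext (fun s => lext (fun t => cbasis (val s * val t)%g) g) f.
Proof.
apply: eq_bigr => s _; rewrite /lext scaler_sumr.
by apply: eq_bigr => t _; rewrite scalerA.
Qed.

Fact cmulDl f g h : cmul (f + g) h = cmul f h + cmul g h.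
Proof. by rewrite !cmulE lextD. Qed.

Fact cmulZl c f g : cmul (c *: f) g = c *: cmul f g.
Proof. by rewrite !cmulE lextZ. Qed.

Fact cmulDr f g h : cmul f (g + h) = cmul f g + cmul f h.
Proof.
rewrite !cmulE /lext -big_split /=; apply: eq_bigr => s _.
by rewrite -scalerDr; congr (_ *: _); exact: lextD.
Qed.

Fact cmulZr c f g : cmul f (c *: g) = c *: cmul f g.
Proof.
rewrite !cmulE [RHS]scaler_sumr; apply: eq_bigr => s _.
by rewrite lextZ !scalerA mulrC.
Qed.

Fact cmul_basis (s t : T) : cmul (cbasis s) (cbasis t) = cbasis (s * t)%g.
Proof.
have cb0 : cbasis szero = 0 by rewrite /cbasis insubF // eqxx.
have [->|s0] := eqVneq s szero.
  by rewrite smul0s cb0 /cmul msupp0 big_seq_fset0.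
have [->|t0] := eqVneq t szero.
  by rewrite smuls0 cb0 /cmul big1 // => u _; rewrite msupp0 big_seq_fset0.
have cbE r (r0 : r != szero) : cbasis r = << (Sub r r0 : nonzero) >>.
  by rewrite /cbasis insubT.
rewrite (cbE _ s0) (cbE _ t0) /cmul !msuppU oner_eq0.
by rewrite !big_seq_fset1 !mcoeffUU mulr1 scale1r.
Qed.

Fact contracted_ind (P : contracted -> Prop) :
  (forall f g, P f -> P g -> P (f + g)) ->
  (forall c f, P f -> P (c *: f)) -> (forall t, P (cbasis t)) ->
  forall f, P f.
Proof.
move=> PD PZ Pb f.
have -> : f = \sum_(s <- msupp f) f@_s *: cbasis (val s).
  rewrite {1}[f]monalgE; apply: eq_bigr => s _; rewrite /cbasis valK.
  by apply/malgP => t; rewrite mcoeffZ !mcoeffU mulrnAr mulr1.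
elim/big_ind: _ => // [|s _]; last exact: PZ.
by rewrite -(scale0r (cbasis szero)); apply: PZ.
Qed.

Fact cmulA : associative cmul.
Proof.
move=> f g h; elim/contracted_ind: f => [f f' IH IH'|c f IH|r].
- by rewrite !cmulDl IH IH'.
- by rewrite !cmulZl IH.
elim/contracted_ind: g => [f f' IH IH'|c f IH|s].
- by rewrite !(cmulDl, cmulDr) IH IH'.
- by rewrite !(cmulZl, cmulZr) IH.
elim/contracted_ind: h => [f f' IH IH'|c f IH|t].
- by rewrite !cmulDr IH IH'.
- by rewrite !cmulZr IH.
by rewrite !cmul_basis mulgA.
Qed.

HB.instance Definition _ := isSemigroup.Build contracted cmulA.
HB.instance Definition _ :=
  Lmodule_isNUAlgebra.Build K contracted cmulDl cmulDr cmulZl cmulZr.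

End ContractedAlgebra.

Arguments contracted_sub K {T} B.

Section Degree.
Context {R : realType} {F : semigroupType}.

Definition degree_function (d : F -> R) := {morph d : u v / (u * v)%g >-> u + v}.

Variables (d : F -> R) (I : sideal F).

Definition rees_pos : set (rees I) :=
  [set s | if s is Some w then 0 < d (val w) else True].

Definition rees_neg : set (rees I) :=
  [set s | if s is Some w then d (val w) < 0 else True].

End Degree.

Arguments rees_pos {R F} d I.
Arguments rees_neg {R F} d I.

Section InfiniteWord.
Variables (A : choiceType) (Omega : nat -> A).

Definition subword (w : free_semigroup A) := exists k n, w = block Omega k n.

Fact nonsubword_subproof : semigroup_ideal [set w | ~ subword w].
Proof.
move=> x y /= Ny; split=> -[k [n]] /(congr1 (@letters A)) /= e; apply: Ny.
- have {}e : x ++ y = [seq Omega i | i <- iota k n.+1] by [].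
  have sz := congr1 size e; rewrite size_cat size_map size_iota in sz.
  have [m ym] : exists m, size y = m.+1.
    by case: y {e sz} => -[|z s] //= _; exists (size s).
  exists (k + size x)%N, m; apply: val_inj => /=.
  rewrite -[LHS](drop_size_cat y (erefl (size x))) e -sz ym -map_drop.
  by rewrite drop_iota addKn.
- have {}e : y ++ x = [seq Omega i | i <- iota k n.+1] by [].
  have sz := congr1 size e; rewrite size_cat size_map size_iota in sz.
  have [m ym] : exists m, size y = m.+1.
    by case: y {e sz} => -[|z s] //= _; exists (size s).
  exists k, m; apply: val_inj => /=.
  rewrite -[LHS](take_size_cat x (erefl (size y))) e -sz ym -map_take.
  by rewrite take_iota (minn_idPl _) // leq_addr.
Qed.

(* S(Omega) is [rees (nonsubwords Omega)]. *)
Definition nonsubwords : sideal (free_semigroup A) :=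
  SIdeal nonsubword_subproof.

(* Automatic over a finite alphabet. Over an infinite one it is necessary for
   K_0 S(Omega) not to be nil: each element f involves only finitely many
   letters, and f^n <> 0 requires a block of length at least n in these
   letters (there is none for large n if, say, the letters of Omega are
   pairwise distinct). *)
Definition long_blocks_over_finite_set :=
  exists L : {fset A}, forall n, exists k,
    forall i, (i < n)%N -> Omega (k + i)%N \in L.

End InfiniteWord.

(* Main.v *)
(* Since no word has degree zero, splitting supports by the sign of the degree
   gives (2). A finite subset of the positive part has all its degrees at least
   some r > 0, and so does everything it generates, as a subalgebra or as an
   ideal of the positive part; a product of n elements then has degrees at least
   n r, while degrees outside the ideal of relations are bounded, whence (3).
   For (1), the n-th power of a sum of finitely many letters is the sum of all
   words of length n in these letters, and distinct words outside the ideal of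
   relations do not cancel; long blocks of an infinite word with bounded prefix
   degrees lie outside it. *)
Require Import Defs.
From HB Require Import structures.
From mathcomp Require Import all_boot all_order all_algebra finmap.
From mathcomp Require Import boolp classical_sets functions cardinality reals.
From mathcomp Require Import monalg.

Set Implicit Arguments.
Unset Strict Implicit.
Unset Printing Implicit Defensive.

Import Order.TTheory GRing.Theory Num.Theory.

Local Open Scope classical_set_scope.
Local Open Scope ring_scope.

(** * Generated sets, nilpotency of subsets, and positive lower bounds *)

Lemma smallest_min (T : Type) (C : set T -> Prop) (G B : set T) :
  C B -> G `<=` B -> smallest C G `<=` B.
Proof. by move=> CB GB x; apply. Qed.

Lemma nilpotent_algebraS (K : pzRingType) (A : nuAlgType K) (B C : set A) :
  B `<=` C -> nilpotent_algebra C -> nilpotent_algebra B.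
Proof.
by move=> BC [n Cn]; exists n => x s sn Bs; apply: Cn => // y /Bs/BC.
Qed.

Lemma exists_pos_lower_bound (R : realDomainType) (T : eqType) (s : seq T)
    (g : T -> R) :
  (forall t, t \in s -> 0 < g t) ->
  exists2 r, 0 < r & forall t, t \in s -> r <= g t.
Proof.
elim: s => [|t s IHs] s_gt0; first by exists 1.
have [|r r_gt0 rle] := IHs.
  by move=> u us; apply: s_gt0; rewrite inE us orbT.
exists (Num.min (g t) r); first by rewrite lt_min r_gt0 s_gt0 ?mem_head.
move=> u; rewrite inE => /predU1P[->|/rle ru]; first by rewrite ge_min lexx.
by rewrite ge_min ru orbT.
Qed.

(** * Subspaces of a contracted algebra cut out by conditions on the support *)

Section Contracted.
Variables (K : fieldType) (T : semigroup0Type).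
Implicit Types (B C D : set T) (f g : contracted K T) (s t : T).

Lemma cbasis_sub B t : B t -> contracted_sub K B (cbasis K t).
Proof.
move=> Bt s; rewrite /cbasis; case: insubP => [u _ ut|_]; last first.
  by rewrite msupp0.
by rewrite msuppU oner_eq0 inE => /eqP ->; rewrite ut.
Qed.

Lemma mcoeff_cbasis t (s : nonzero T) : (cbasis K t)@_s = (t == val s)%:R.
Proof.
rewrite /cbasis; case: insubP => [u _ <-|/negPn/eqP ->].
  by rewrite mcoeffU (inj_eq val_inj).
by rewrite mcoeff0 eq_sym (negPf (valP s)).
Qed.

Lemma contracted_sub_subspace B : subspace (contracted_sub K B).
Proof.
split=> [s|f g fB gB s|c f fB s]; first by rewrite msupp0.
  by move/(fsubsetP (msuppD_le _ _)); rewrite in_fsetU => /orP[/fB|/gB].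
by move/(fsubsetP (msuppZ_le _ _))/fB.
Qed.

Lemma contracted_sub_mul B C D f g :
  (forall s t, B s -> C t -> D (s * t)%g) ->
  contracted_sub K B f -> contracted_sub K C g -> contracted_sub K D (f * g)%g.
Proof.
move=> BCD fB gC; have [D0 DD DZ] := contracted_sub_subspace D.
rewrite -[(f * g)%g]/(cmul f g) /cmul big_seq.
elim/big_ind: _ => // s sf; rewrite big_seq.
by elim/big_ind: _ => // t tg; apply: DZ; apply: cbasis_sub; apply: BCD;
  [exact: fB|exact: gC].
Qed.

Lemma contracted_subS B C :
  B `<=` C -> contracted_sub K B `<=` contracted_sub K C.
Proof. by move=> BC f fB s /fB/BC. Qed.

Lemma contracted_subI B C :
  contracted_sub K B `&` contracted_sub K C `<=` contracted_sub K (B `&` C).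
Proof. by move=> f [fB fC] s sf; split; [exact: fB | exact: fC]. Qed.

Lemma contracted_sub0 : contracted_sub K [set (szero : T)] = [set 0].
Proof.
apply/seteqP; split=> f /=; last by move=> -> s; rewrite msupp0.
move=> f0; apply/malgP => s; rewrite mcoeff0 mcoeff_outdom //.
by apply: contra (valP s) => /f0 /= ->.
Qed.

Lemma contracted_sub_subalgebra B :
  (forall s t, B s -> B t -> B (s * t)%g) -> subalgebra (contracted_sub K B).
Proof.
move=> BM; split; first exact: contracted_sub_subspace.
by move=> f g; apply: contracted_sub_mul.
Qed.

Lemma contracted_sub_ideal B C : C `<=` B ->
  (forall s t, B s -> C t -> C (s * t)%g) ->
  (forall s t, C s -> B t -> C (s * t)%g) ->
  ideal_of (contracted_sub K B) (contracted_sub K C).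
Proof.
move=> CB BC CB'; split; [exact: contracted_subS|exact: contracted_sub_subspace|].
by move=> f g fB gC; split; [apply: contracted_sub_mul fB gC|
                              apply: contracted_sub_mul gC fB].
Qed.

(** Every basis element lies in [B] or in [C], which gives the sum by linearity; a support inside
    both could contain only zero, hence is empty. *)
Lemma contracted_direct_sum B C : B `|` C = setT -> B `&` C = [set szero] ->
  direct_sum (contracted_sub K B) (contracted_sub K C).
Proof.
move=> BUC BIC; split=> [f|]; last first.
  apply/seteqP; split=> [f|_ ->].
    move=> fBC; have : contracted_sub K (B `&` C) f by exact: contracted_subI.
    by rewrite BIC contracted_sub0.
  by split; case: (contracted_sub_subspace B); case: (contracted_sub_subspace C).
elim/contracted_ind: f => [f g [u [v [uB vC ->]]] [u' [v' [uB' vC' ->]]]||t].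
- exists (u + u'), (v + v'); rewrite addrACA.
  by split=> //; [case: (contracted_sub_subspace B) => _ + _|
                  case: (contracted_sub_subspace C) => _ + _]; apply.
- move=> c f [u [v [uB vC ->]]]; exists (c *: u), (c *: v); rewrite scalerDr.
  by split=> //; [case: (contracted_sub_subspace B) => _ _|
                  case: (contracted_sub_subspace C) => _ _]; apply.
have : (B `|` C) t by rewrite BUC.
case=> [Bt|Ct]; [exists (cbasis K t), 0|exists 0, (cbasis K t)].
  rewrite addr0; split=> //; first exact: cbasis_sub.
  by case: (contracted_sub_subspace C).
rewrite add0r; split=> //; last exact: cbasis_sub.
by case: (contracted_sub_subspace B).
Qed.

End Contracted.

(** * The degree filtration of the positive part and its nilpotency *)

Section Graded.
Variables (K : fieldType) (R : realType) (F : semigroupType).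
Variables (d : F -> R) (I : sideal F).
Hypothesis d_degree : degree_function d.

(** A product that falls into [I] is zero, where nothing is claimed, so [P] only has to be checked
    on products of representatives. *)
Lemma rees_mulP (P : F -> Prop) (s t : rees I) :
  (forall u v, s = Some u -> t = Some v -> P (val u * val v)%g) ->
  if (s * t)%g is Some w then P (val w) else True.
Proof.
case: s t => [u|] [v|] //= Puv; rewrite -[(_ * _)%g]/(rees_mul _ _) /=.
by case: insubP => //= w _ ->; apply: Puv.
Qed.

Definition rees_ge (r : R) : set (rees I) :=
  [set s | if s is Some w then r <= d (val w) else True].

Lemma rees_pos_mul (s t : rees I) :
  rees_pos d I s -> rees_pos d I t -> rees_pos d I (s * t)%g.
Proof.
move=> s_gt0 t_gt0; apply: (@rees_mulP (fun w => 0 < d w)) => u v su tv.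
by rewrite d_degree; apply: addr_gt0; move: s_gt0 t_gt0; rewrite su tv.
Qed.

Lemma rees_ge_mul r1 r2 (s t : rees I) :
  rees_ge r1 s -> rees_ge r2 t -> rees_ge (r1 + r2) (s * t)%g.
Proof.
move=> s_ge t_ge; apply: (@rees_mulP (fun w => r1 + r2 <= d w)) => u v su tv.
by rewrite d_degree; apply: lerD; move: s_ge t_ge; rewrite su tv.
Qed.

Lemma rees_ge_le r1 r2 : r1 <= r2 -> rees_ge r2 `<=` rees_ge r1.
Proof. by move=> r12 [w|] //=; exact: le_trans. Qed.

Lemma rees_ge_pos r : 0 < r -> rees_ge r `<=` rees_pos d I.
Proof. by move=> r_gt0 [w|] //=; exact: lt_le_trans. Qed.

Lemma rees_pos_ge : rees_pos d I `<=` rees_ge 0.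
Proof. by move=> [w|] //=; exact: ltW. Qed.

Lemma rees_ge_subalgebra r :
  0 < r -> subalgebra (contracted_sub K (rees_ge r)).
Proof.
move=> r_gt0; apply: contracted_sub_subalgebra => s t s_ge t_ge.
by apply: rees_ge_le (rees_ge_mul s_ge t_ge); rewrite lerDl ltW.
Qed.

(** A factor of positive degree can only raise the degree, so the bound [r] survives multiplication
    by the positive part on either side. *)
Lemma rees_ge_ideal r : 0 < r ->
  ideal_of (contracted_sub K (rees_pos d I)) (contracted_sub K (rees_ge r)).
Proof.
move=> r_gt0; apply: contracted_sub_ideal; first exact: rees_ge_pos.
- by move=> s t /rees_pos_ge s_ge t_ge; rewrite -[r]add0r; apply: rees_ge_mul.
- by move=> s t s_ge /rees_pos_ge t_ge; rewrite -[r]addr0; apply: rees_ge_mul.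
Qed.

(** Finitely many elements involve only finitely many basis elements, and finitely many positive
    degrees have a positive lower bound. *)
Lemma finite_rees_ge (G : set (contracted K (rees I))) :
  finite_set G -> G `<=` contracted_sub K (rees_pos d I) ->
  exists2 r, 0 < r & G `<=` contracted_sub K (rees_ge r).
Proof.
move=> /finite_seqP[s ->] Gpos.
(* The value 1 at zero is a positive dummy: it keeps [g] positive without having to rule that case
   out. *)
pose g (t : nonzero (rees I)) := if val t is Some w then d (val w) else 1.
have [|r r_gt0 rle] := @exists_pos_lower_bound R _
    (flatten [seq (msupp f : seq _) | f <- s]) g.
  move=> t /flatten_mapP[f fs tf]; have := Gpos f fs t tf.
  by rewrite /g /rees_pos /=; case: (\val t).
exists r => // f fs t tf; have : r <= g t by apply/rle/flatten_mapP; exists f.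
by rewrite /g /rees_ge /=; case: (\val t).
Qed.

Hypothesis d_bounded : exists C, forall w, w \notin (I : set F) -> d w < C.

Lemma rees_ge_nilpotent r :
  0 < r -> nilpotent_algebra (contracted_sub K (rees_ge r)).
Proof.
move=> r_gt0; have [C dC] := d_bounded.
(* By the Archimedean property [n] exceeds [C / r]. A head and a list of size [n] make [n.+1]
   factors, of total degree at least [C]. *)
pose n := Num.bound `|C / r|.
have Cn : C <= r *+ n.+1.
  rewrite -mulr_natl -ler_pdivrMr // (le_trans (ler_norm _)) //.
  by rewrite (le_trans (ltW (archi_boundP (normr_ge0 _)))) // ler_nat leqnSn.
exists n => x s sn sge.
have : contracted_sub K (rees_ge (r *+ n.+1)) (foldl (fun u v => (u * v)%g) x s).
  rewrite -{}sn {n Cn}; elim/last_ind: s => [|s y IHs] in sge *.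
    by rewrite mulr1n; apply: sge; rewrite mem_head.
  rewrite size_rcons foldl_rcons mulrSr.
  apply: (@contracted_sub_mul K _ (rees_ge (r *+ (size s).+1)) (rees_ge r)).
  - by move=> ? ?; exact: rees_ge_mul.
  - apply: IHs => z; rewrite inE => zs; apply: sge.
    by rewrite inE mem_rcons inE; case/orP: zs => ->; rewrite ?orbT.
  - by apply: sge; rewrite inE mem_rcons mem_head orbT.
(* No word outside [I] reaches degree [C], so only zero is left. *)
have sub0 : rees_ge (r *+ n.+1) `<=` [set (szero : rees I)].
  by move=> [w|] //= /(le_trans Cn); rewrite leNgt dC // (valP w).
by rewrite -[_ = 0]/([set 0] _) -contracted_sub0; exact: contracted_subS.
Qed.

Lemma rees_pos_locally_nilpotent :
  locally_nilpotent (contracted_sub K (rees_pos d I)).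
Proof.
move=> G finG /(finite_rees_ge finG)[r r_gt0 Gr].
apply: nilpotent_algebraS (rees_ge_nilpotent r_gt0).
exact: smallest_min (rees_ge_subalgebra r_gt0) Gr.
Qed.

Lemma rees_pos_fg_ideals_nilpotent :
  fg_ideals_nilpotent (contracted_sub K (rees_pos d I)).
Proof.
move=> G finG /(finite_rees_ge finG)[r r_gt0 Gr].
apply: nilpotent_algebraS (rees_ge_nilpotent r_gt0).
exact: smallest_min (rees_ge_ideal r_gt0) Gr.
Qed.

End Graded.

(** Passing from [d] to its negative swaps the two parts, so every result on the positive part also
    serves the negative one. *)
Lemma rees_negE (R : realType) (F : semigroupType) (d : F -> R) (I : sideal F) :
  rees_neg d I = rees_pos (fun w => - d w) I.
Proof.
by apply/funext => -[w|] //; rewrite /rees_neg /rees_pos /= oppr_gt0.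
Qed.

Lemma degree_functionN (R : realType) (F : semigroupType) (d : F -> R) :
  degree_function d -> degree_function (fun w => - d w).
Proof. by move=> dD u v; rewrite dD opprD. Qed.

Lemma rees_direct_sum (K : fieldType) (R : realType) (F : semigroupType)
    (d : F -> R) (I : sideal F) : (forall w, d w != 0) ->
  direct_sum (contracted_sub K (rees_pos d I)) (contracted_sub K (rees_neg d I)).
Proof.
move=> d_neq0; apply: contracted_direct_sum; apply/seteqP; split=> [[w|]|[w|]] //=.
- by move=> _; case: (ltgtP (d (\val w)) 0) (d_neq0 (\val w)) => // dw _;
    [right|left].
- by left.
- by move=> [dw] /(lt_trans dw); rewrite ltxx.
Qed.

(** * Powers of a sum of letters and non-nilpotency *)

Section Words.
Variables (K : fieldType) (A : choiceType).
Implicit Types (I : sideal (free_semigroup A)) (L : {fset A}).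

Definition rees_proj I (w : free_semigroup A) : rees I := insub w.

Lemma rees_projM I u v :
  (rees_proj I u * rees_proj I v)%g = rees_proj I (u * v)%g.
Proof.
rewrite -[LHS]/(rees_mul _ _) /rees_mul /rees_proj.
case: insubP => [u' _ ->|/negPn/set_mem uI]; last first.
  by rewrite insubF //; apply/negPn/mem_set; case: (sidealP v uI).
case: insubP => [v' _ ->|/negPn/set_mem vI] //.
by rewrite insubF //; apply/negPn/mem_set; case: (sidealP u vI).
Qed.

(** It suffices that [w] is outside [I]: if [u] lies in [I], its image is zero, which is not the
    image of [w]. *)
Lemma rees_proj_eq I u w :
  w \notin (I : set _) -> (rees_proj I u == rees_proj I w) = (u == w).
Proof.
move=> wI; apply/eqP/eqP => [|-> //]; rewrite /rees_proj.
rewrite (insubT (fun w => w \notin (I : set _)) wI).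
by case: insubP => // u' _ <- [->].
Qed.

(** The index [n] stands for length [n.+1], matching [iter n], which yields the power with [n.+1]
    factors. *)
Fixpoint words L n : seq (free_semigroup A) :=
  if n is n'.+1 then [seq (letter z * w)%g | z <- L, w <- words L n']
  else [seq letter z | z <- L].

Lemma words_uniq L n : uniq (words L n).
Proof.
elim: n => [|n IHn] /=.
  by rewrite map_inj_uniq ?fset_uniq // => y z /(congr1 val) [].
apply: allpairs_uniq => [|//|[y u] [z v] _ _ /= /(congr1 val) [-> uv]].
  exact: fset_uniq.
by congr pair; apply: val_inj.
Qed.

Lemma mem_words L (w : free_semigroup A) n :
  size w = n.+1 -> {subset letters w <= L} -> w \in words L n.
Proof.
case: w => s s0 /=; elim: n s s0 => [|n IHn] [|z s] //= s0 [sn] sL.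
  move: s0 sL; rewrite (size0nil sn) => s0 sL; apply/mapP; exists z.
    by rewrite sL ?mem_head.
  exact: val_inj.
have t0 : ~~ nilp s by rewrite /nilp sn.
apply/allpairsP; exists (z, Word t0); split=> /=.
- by rewrite sL ?mem_head.
- by apply: IHn => // y ys; rewrite sL // inE ys orbT.
- exact: val_inj.
Qed.

Definition letter_sum I L : contracted K (rees I) :=
  \sum_(z <- L) cbasis K (rees_proj I (letter z)).

Lemma letter_sum_pow I L n :
  iter n (fun g => (letter_sum I L * g)%g) (letter_sum I L) =
  \sum_(w <- words L n) cbasis K (rees_proj I w).
Proof.
elim: n => [|n IHn] /=; first by rewrite big_map.
rewrite {}IHn big_allpairs_dep /= {1}/letter_sum.
(* Zero is written as [0 *: 0], and the scalar is pulled out of the product. *)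
have mul0s (g : contracted K (rees I)) : (0 * g)%g = 0.
  by have := nuscaleAl (0 : K) 0 g; rewrite !scale0r.
have muls0 (g : contracted K (rees I)) : (g * 0)%g = 0.
  by have := nuscaleAr (0 : K) g 0; rewrite !scale0r.
rewrite (big_morph (fun f => (f * _)%g) (fun f g => numulDl f g _) (mul0s _)).
apply: eq_bigr => z _.
rewrite (big_morph (fun f => (_ * f)%g) (fun f g => numulDr _ f g) (muls0 _)).
by apply: eq_bigr => w _; rewrite [LHS]cmul_basis rees_projM.
Qed.

(** The word [w] of length [n.+1] occurs exactly once in the expanded power of [letter_sum I L], and
    no other word has the same image. Its coefficient is therefore 1, in any characteristic. *)
Lemma not_nil_long_words I L :
  (forall n, exists w : free_semigroup A,
    [/\ size w = n.+1, {subset letters w <= L} & w \notin (I : set _)]) ->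
  ~ nil_algebra [set: contracted K (rees I)].
Proof.
move=> long nilK; have [n] := nilK (letter_sum I L) Logic.I.
rewrite letter_sum_pow; have [w [wn wL wI]] := long n => sum0.
have w0 : rees_proj I w != szero by rewrite /rees_proj insubT.
pose s : nonzero (rees I) := exist _ (rees_proj I w) w0.
have := congr1 (fun f : contracted K (rees I) => f@_s) sum0.
rewrite mcoeff0 raddf_sum /= (bigD1_seq w) ?words_uniq ?mem_words //=.
rewrite big1 => [|u uw]; rewrite mcoeff_cbasis /= rees_proj_eq //.
  by rewrite eqxx addr0 => /eqP; rewrite oner_eq0.
by rewrite (negPf uw).
Qed.

End Words.

(** * Degrees of blocks as differences of prefix degrees *)

Section WordDegree.
Variables (A : choiceType) (R : realType) (d : free_semigroup A -> R).
Hypothesis d_degree : degree_function d.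

Lemma degree_sum (w : free_semigroup A) : d w = \sum_(z <- w) d (letter z).
Proof.
case: w => -[//|z s] s0 /=; elim: s z s0 => [|y s IHs] z s0.
  by rewrite big_seq1; congr d; apply: val_inj.
by rewrite big_cons -(IHs y isT) -d_degree; congr d; apply: val_inj.
Qed.

Variable Omega : nat -> A.

Lemma block_degree k n :
  d (block Omega k n) = \sum_(0 <= i < k + n.+1) d (letter (Omega i)) -
                        \sum_(0 <= i < k) d (letter (Omega i)).
Proof.
rewrite degree_sum -[letters _]/(map _ (iota k n.+1)) big_map.
by rewrite (big_cat_nat (n := k)) ?leq_addr // addrAC subrr add0r
  /index_iota addKn.
Qed.

(** Two numbers of the half-open interval from [- b] (excluded) to [a] (included) differ by strictly
    less than [a + b]. *)
Lemma subword_degree_bound (a b : R) (w : free_semigroup A) :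
  (forall n, - b < \sum_(0 <= i < n) d (letter (Omega i)) <= a) ->
  subword Omega w -> `|d w| < a + b.
Proof.
move=> bnd [k [n ->]]; rewrite block_degree ltr_norml.
have /andP[h1 h2] := bnd (k + n.+1)%N; have /andP[h3 h4] := bnd k.
apply/andP; split; rewrite ?opprD.
  by rewrite addrC ltr_leD ?lerN2.
by apply: ler_ltD => //; rewrite ltrNl.
Qed.

End WordDegree.

(** * Prefix degrees of a word over two letters *)

Section GreedyWord.
Variables (R : realDomainType) (u v : R).

(* Prefix degrees of the greedy word; the value [a] is attained when [u = a],
   so the word need not be admissible, but differences stay below [a + b]. *)
Fixpoint greedy_sum n : R :=
  if n is n'.+1 then greedy_sum n' + (if greedy_sum n' <= 0 then u else v)
  else 0.

(** The sum rises, by at most [a], only from values at most 0, and falls, by at most [b], only from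
    positive values; so it cannot leave the interval. *)
Lemma greedy_sum_bound (a b : R) n :
  0 < a -> 0 < b -> 0 < u <= a -> - b <= v < 0 -> - b < greedy_sum n <= a.
Proof.
move=> a0 b0 /andP[u0 ua] /andP[vb v0].
elim: n => [|n /andP[IHl IHr]] /=; first by rewrite oppr_lt0 b0 ltW.
case: (leP (greedy_sum n) 0) => s0; apply/andP; split.
- by rewrite (lt_le_trans IHl) // lerDl ltW.
- by rewrite -[a]add0r lerD.
- by rewrite -[- b]add0r ltr_leD.
- by rewrite (le_trans _ IHr) // gerDl ltW.
Qed.

End GreedyWord.

(** The degree of a word is a combination of letter degrees whose coefficients are the letter
    multiplicities. If it vanished, all multiplicities would, yet a word has at least one letter. *)
Lemma degree_neq0 (R : realType) (X Y : choiceType)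
    (d : free_semigroup (X + Y)%type -> R) :
  degree_function d ->
  (forall (A : {fset X}) (B : {fset Y}) (p : X -> rat) (q : Y -> rat),
    (forall x, x \in A -> 0 <= p x) -> (forall y, y \in B -> 0 <= q y) ->
    \sum_(x <- A) ratr (p x) * d (letter (inl x)) +
      \sum_(y <- B) ratr (q y) * d (letter (inr y)) = 0 ->
    (forall x, x \in A -> p x = 0) /\ (forall y, y \in B -> q y = 0)) ->
  forall w, d w != 0.
Proof.
move=> dD indep w; apply/negP => /eqP.
pose xs := pmap (fun z : X + Y => if z is inl x then Some x else None) w.
pose ys := pmap (fun z : X + Y => if z is inr y then Some y else None) w.
have -> : d w = \sum_(x <- xs) d (letter (inl x)) + \sum_(y <- ys) d (letter (inr y)).
  rewrite degree_sum // /xs /ys; elim: (letters w) => [|[x|y] s IHs] /=.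
  - by rewrite !big_nil addr0.
  - by rewrite !big_cons IHs addrA.
  - by rewrite !big_cons IHs addrCA.
(* Equal letters are grouped, since the independence hypothesis speaks of sums over sets with
   rational coefficients. *)
have sumE (Z : choiceType) (s : seq Z) (g : Z -> R) :
    \sum_(z <- s) g z =
    \sum_(z <- [fset z in s]%fset) ratr (count_mem z s)%:R * g z.
  rewrite -big_undup_iterop_count /=.
  rewrite (perm_big [fset z in s]%fset) /=; last first.
    by apply: uniq_perm; rewrite ?undup_uniq ?fset_uniq // => z;
      rewrite mem_undup in_fset.
  apply: eq_bigr => z _; rewrite ratr_nat mulr_natl.
  by rewrite Monoid.iteropE iter_addr addr0.
rewrite (sumE _ xs) (sumE _ ys) => /indep[||xs0 ys0]; try by move=> *; rewrite ler0n.
have count0 (Z : choiceType) (z : Z) s : z \in s -> (count_mem z s)%:R <> 0 :> rat.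
  by move=> zs /eqP; rewrite pnatr_eq0 -leqn0 leqNgt -has_count has_pred1 zs.
(* The first letter of [w] lies in [xs] or in [ys], so its multiplicity is not zero. *)
case: w @xs @ys xs0 ys0 => -[|[z|z] s] // s0 xs ys xs0 ys0.
  by apply: (count0 _ z xs); rewrite ?xs0 ?in_fset /xs //= mem_head.
by apply: (count0 _ z ys); rewrite ?ys0 ?in_fset /ys //= mem_head.
Qed.

Theorem corollary5 (K : fieldType) (R : realType) (X Y : choiceType)
  (d : free_semigroup (X + Y)%type -> R) (a b : R) (x0 : X) (y0 : Y)
  (d_degree : degree_function d)
  (dX : forall x : X, 0 < d (letter (inl x)))
  (dY : forall y : Y, d (letter (inr y)) < 0)
  (d_indep : forall (A : {fset X}) (B : {fset Y}) (p : X -> rat) (q : Y -> rat),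
    (forall x, x \in A -> 0 <= p x) -> (forall y, y \in B -> 0 <= q y) ->
    \sum_(x <- A) ratr (p x) * d (letter (inl x)) +
      \sum_(y <- B) ratr (q y) * d (letter (inr y)) = 0 ->
    (forall x, x \in A -> p x = 0) /\ (forall y, y \in B -> q y = 0))
  (a_gt0 : 0 < a) (b_gt0 : 0 < b)
  (dx0 : d (letter (inl x0)) <= a) (dy0 : - b <= d (letter (inr y0))) :
  let I_S := gen_ideal [set w | a + b <= `|d w|] in
  let I_Omega := fun Omega : nat -> (X + Y)%type => nonsubwords Omega in
  let admissible := fun Omega : nat -> (X + Y)%type =>
    forall n, - b < d (block Omega 0 n) < a in
  let K0 := fun I : sideal (free_semigroup (X + Y)%type) => contracted K (rees I) in
  let K0pos := fun I : sideal (free_semigroup (X + Y)%type) => contracted_sub K (rees_pos d I) in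
  let K0neg := fun I : sideal (free_semigroup (X + Y)%type) => contracted_sub K (rees_neg d I) in
  let nil_claim := fun I : sideal (free_semigroup (X + Y)%type) => ~ nil_algebra [set: K0 I] in
  let sum_claim := fun I : sideal (free_semigroup (X + Y)%type) =>
    [/\ subalgebra (K0pos I), subalgebra (K0neg I)
      & direct_sum (K0pos I) (K0neg I)] in
  let nilpotence_claim := fun I : sideal (free_semigroup (X + Y)%type) =>
    [/\ locally_nilpotent (K0pos I), locally_nilpotent (K0neg I),
        fg_ideals_nilpotent (K0pos I) & fg_ideals_nilpotent (K0neg I)] in
  [/\ nil_claim I_S /\
      (forall Omega, admissible Omega -> long_blocks_over_finite_set Omega ->
        nil_claim (I_Omega Omega)),
      sum_claim I_S /\
      (forall Omega, admissible Omega -> sum_claim (I_Omega Omega))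
    & nilpotence_claim I_S /\
      (forall Omega, admissible Omega -> nilpotence_claim (I_Omega Omega))].
Proof.
move=> I_S I_Omega admissible K0 K0pos K0neg nil_claim sum_claim nilpotence_claim.
have d_neq0 := degree_neq0 d_degree d_indep.
have dN_degree := degree_functionN d_degree.
have sums I : sum_claim I.
  rewrite /sum_claim /K0neg; split; last exact: rees_direct_sum.
    by apply: contracted_sub_subalgebra; exact: rees_pos_mul.
  rewrite rees_negE; apply: contracted_sub_subalgebra; exact: rees_pos_mul.
have nilpotence (I : sideal (free_semigroup (X + Y)%type)) :
    (forall w, w \notin (I : set _) -> `|d w| < a + b) -> nilpotence_claim I.
  move=> bnd.
  have bndp : exists C, forall w, w \notin (I : set _) -> d w < C.
    by exists (a + b) => w /bnd; exact/le_lt_trans/ler_norm.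
  have bndn : exists C, forall w, w \notin (I : set _) -> - d w < C.
    by exists (a + b) => w /bnd; rewrite -normrN; exact/le_lt_trans/ler_norm.
  rewrite /nilpotence_claim /K0neg rees_negE; split.
  - exact: rees_pos_locally_nilpotent.
  - exact: rees_pos_locally_nilpotent.
  - exact: rees_pos_fg_ideals_nilpotent.
  - exact: rees_pos_fg_ideals_nilpotent.
split; split=> //.
(* The greedy word over [x0] and [y0] supplies arbitrarily long words in two letters that stay
   nonzero in the quotient by [I_S]. *)
- pose u := d (letter (inl x0)); pose v := d (letter (inr y0)).
  pose Omega n : (X + Y)%type := if greedy_sum u v n <= 0 then inl x0 else inr y0.
  have sumE n : \sum_(0 <= i < n) d (letter (Omega i)) = greedy_sum u v n.
    elim: n => [|n IHn]; first by rewrite big_nil.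
    by rewrite big_nat_recr //= IHn /Omega; case: ifP.
  apply: (@not_nil_long_words _ _ _ [fset inl x0; inr y0]%fset) => n.
  exists (block Omega 0 n); split.
  + by rewrite size_map size_iota.
  + move=> z /mapP[i _ ->]; rewrite !inE /Omega.
    by case: ifP; rewrite eqxx ?orbT.
  + apply/negP => /set_mem.
    (* The generators of [I_S] have too large a degree to be subwords of [Omega], and the
       non-subwords already form an ideal. *)
    have : I_S `<=` nonsubwords Omega.
      apply: smallest_min => [|w /= wab /(@subword_degree_bound _ _ _ d_degree)].
        exact: sidealP.
      move=> /(_ a b); rewrite ltNge wab => /(_ _)/negP; apply => // m.
      by rewrite sumE; apply: greedy_sum_bound; rewrite // ?dX ?dY ?andbT.
    by move=> sub wI; have : ~ subword Omega _ := sub _ wI; apply; exists 0%N, n.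
- move=> Omega _ [L longL]; apply: (@not_nil_long_words _ _ _ L) => n.
  have [k kL] := longL n.+1; exists (block Omega k n); split.
  + by rewrite size_map size_iota.
  + move=> z /mapP[i]; rewrite mem_iota => /andP[ki ik] ->.
    by rewrite -(subnKC ki); apply: kL; rewrite ltn_subLR.
  + by apply/negP => /set_mem; apply; exists k, n.
(* A word of absolute degree at least [a + b] is itself a generator of [I_S]. *)
- apply: nilpotence => w wI; rewrite ltNge; apply: contra wI => wab.
  by apply/mem_set => J [_]; apply.
- move=> Omega adm; apply: nilpotence => w wI.
  apply: (subword_degree_bound d_degree (Omega := Omega)) => [n|]; last first.
    by apply: contrapT => Nw; move/negP: wI; apply; apply/mem_set.
  (* Admissibility concerns nonempty prefixes only, [block Omega 0 n] having [n.+1] letters; the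
     empty prefix has degree sum 0, which also lies in the interval. *)
  case: n => [|n]; first by rewrite big_nil oppr_lt0 b_gt0 ltW.
  have := adm n; rewrite block_degree // add0n [X in _ - X]big_geq // subr0.
  by case/andP=> -> /ltW.
Qed.
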